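(* The following are orthonormal OP bases on the curves $\gamma_{m,d}$ with respect to $\langle\cdot,\cdot\rangle_{\gamma_{m,d},w}$. (1) If $m=1$ and $\deg\phi=1$: $Y^{(1,1)}_{n,1}=P^{(1,1)}_{n,0}$ for $n\ge0$. (2) If $m=1$ and $\deg\phi=2$: $Y^{(1,2)}_{0,1}=P^{(1,2)}_{0,0}$ and, for $n\ge1$, $Y^{(1,2)}_{n,1}=P^{(1,2)}_{2n-1,0}$, $Y^{(1,2)}_{n,2}=P^{(1,2)}_{2n,0}$. (3) If $m=2$ and $d=\deg\phi\in\{1,2\}$: $Y^{(2,d)}_{0,1}=P^{(2,d)}_{0,0}$ and, for $n\ge1$, $Y^{(2,d)}_{n,1}=P^{(2,d)}_{n,0}$, $Y^{(2,d)}_{n,2}=P^{(2,d)}_{n,1}$. (4) If $m=2$ and $\deg\phi=3$: $Y^{(2,3)}_{0,1}=P^{(2,3)}_{0,0}$, $Y^{(2,3)}_{1,1}=P^{(2,3)}_{1,0}$, $Y^{(2,3)}_{1,2}=P^{(2,3)}_{1,1}$ and, for $n\ge1$, $$\big(Y^{(2,3)}_{2n,1},Y^{(2,3)}_{2n,2},Y^{(2,3)}_{2n,3}\big)=\big(P^{(2,3)}_{3n-1,0},P^{(2,3)}_{3n-1,1},P^{(2,3)}_{3n,0}\big),$$ $$\big(Y^{(2,3)}_{2n+1,1},Y^{(2,3)}_{2n+1,2},Y^{(2,3)}_{2n+1,3}\big)=\big(P^{(2,3)}_{3n,1},P^{(2,3)}_{3n+1,0},P^{(2,3)}_{3n+1,1}\big).$$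 (5) If $m=2$, $\deg\phi=4$, $\phi$ is even, $\mathrm{supp}(w)=(-a,a)$ with $a>0$ and $w$ is even (so that $P^{(2,4)}_{n,0}$ has the same parity as $n$): $Y^{(2,4)}_{n,i}=P^{(2,4)}_{n,i-1}$ for $(n,i)=(0,1),(1,1),(1,2),(2,1),(2,2)$, $Y^{(2,4)}_{2,3}=P^{(2,4)}_{4,0}$ and, for $n\ge1$, $$\big(Y^{(2,4)}_{2n+1,1},Y^{(2,4)}_{2n+1,2},Y^{(2,4)}_{2n+1,3},Y^{(2,4)}_{2n+1,4}\big)=\big(P^{(2,4)}_{4n-1,0},P^{(2,4)}_{4n-1,1},P^{(2,4)}_{4n+1,0},P^{(2,4)}_{4n+1,1}\big),$$ $$\big(Y^{(2,4)}_{2n+2,1},Y^{(2,4)}_{2n+2,2},Y^{(2,4)}_{2n+2,3},Y^{(2,4)}_{2n+2,4}\big)=\big(P^{(2,4)}_{4n,1},P^{(2,4)}_{4n+2,0},P^{(2,4)}_{4n+2,1},P^{(2,4)}_{4n+4,0}\big).$$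
   Context: Let $w$ be a non-negative weight function whose support is an interval $I=(a,b)$, $(a,\infty)$ or $(-\infty,\infty)$, with all moments finite, and let $\phi$ be a real polynomial of degree $d>0$; if $m=2$ assume $\phi>0$ on $I$ ($\phi$ may vanish at endpoints of $I$). Set $\gamma_{m,d}=\{(x,y)\in\mathbb{R}^2: y^m=\phi(x),\ x\in I\}$ and $\Pi(\gamma_{m,d})=\mathbb{R}[x,y]/\langle y^m-\phi(x)\rangle$. For $m=1$, $\langle f,g\rangle_{\gamma_{1,d},w}=\int_I f(x,\phi(x))g(x,\phi(x))w(x)\,dx$; for $m=2$, $$\langle f,g\rangle_{\gamma_{2,d},w}=\int_I\big[f(x,\sqrt{\phi(x)})g(x,\sqrt{\phi(x)})+f(x,-\sqrt{\phi(x)})g(x,-\sqrt{\phi(x)})\big]w(x)\,dx.$$ $p_n(\omega;x)$ denotes the degree-$n$ orthonormal polynomial with respect to $\int fg\,\omega\,dx$. The $P$-polynomials are: for $m=1$, $P^{(1,d)}_{n,0}=p_n(w;x)$, $n\ge0$; for $m=2$, $P^{(2,d)}_{n,0}=p_n(w;x)/\sqrt2$, $n\ge0$, and $P^{(2,d)}_{n,1}=y\,p_{n-1}(\phi w;x)/\sqrt2$, $n\ge1$. The degree on $\gamma_{m,d}$ of an element of $\Pi(\gamma_{m,d})$ is the lowest total degree among all its representatives in $\mathbb{R}[x,y]$. $\mathcal{V}_n$ is the space of $p\in\Pi(\gamma_{m,d})$ of degree at most $n$ on $\gamma_{m,d}$ that are orthogonal to every $q$ of degree less than $n$ on $\gamma_{m,d}$.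 An orthonormal OP basis on $\gamma_{m,d}$ is a family $Y^{(m,d)}_{n,k}$, $n\ge0$, $1\le k\le\dim\mathcal{V}_n=\min\{n+1,\max\{d,m\}\}$, with $\langle Y^{(m,d)}_{n,k},Y^{(m,d)}_{\ell,i}\rangle_{\gamma_{m,d},w}=\delta_{n,\ell}\delta_{k,i}$, each $Y^{(m,d)}_{n,k}$ having degree $n$ on $\gamma_{m,d}$ (so that $\{Y^{(m,d)}_{n,k}\}_k$ is an orthonormal basis of $\mathcal{V}_n$). *)

(* Defs.v *)
From HB Require Import structures.
From mathcomp Require Import all_boot all_order all_algebra.
From mathcomp Require Import all_classical all_reals all_analysis.

Set Implicit Arguments.
Unset Strict Implicit.
Unset Printing Implicit Defensive.

Import Order.TTheory GRing.Theory Num.Theory.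
Import numFieldNormedType.Exports.

Local Open Scope classical_set_scope.
Local Open Scope ring_scope.

(* Closed support of the measure w(x) dx. Values of w on null sets are
   irrelevant, and w may have isolated zeros inside its support. *)
Definition weight_support (R : realType) (w : R -> R) : set R :=
  [set x | forall U : set R, open U -> U x ->
     (0 < \int[@lebesgue_measure R]_(t in U) (w t)%:E)%E].

Definition admissible_interval (R : realType) (I : set R) : Prop :=
  [\/ exists a b : R, a < b /\ I = [set` `]a, b[],
      exists a : R, I = [set` `]a, +oo[]
    | I = setT].

Record weight_on (R : realType) (I : set R) (w : R -> R) : Prop := WeightOn {
  weight_interval : admissible_interval I;
  weight_measurable : measurable_fun setT w;
  weight_ge0 : forall x, 0 <= w x;
  weight_supportE : weight_support w = closure I;
  weight_moments : forall n : nat,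
    (@lebesgue_measure R).-integrable I (fun x => (x ^+ n * w x)%:E)
}.

(* The sequences (p_n(omega; x))_n; such a sequence is determined by omega up
   to the sign of each p_n, and no choice of signs is imposed. *)
Definition orthonormal_polys (R : realType) (I : set R) (omega : R -> R)
    (p : nat -> {poly R}) : Prop :=
  (forall n, size (p n) = n.+1) /\
  (forall n k, \int[@lebesgue_measure R]_(x in I)
     ((p n).[x] * (p k).[x] * omega x) = (n == k)%:R).

(* R[x, y] is encoded as {poly {poly R}}: the outer variable 'X is y and the
   variable of the coefficients is x, so that f`_j`_i is the coefficient of
   x^i y^j. *)
Definition total_degree (R : realType) (f : {poly {poly R}}) : nat :=
  \max_(j < size f) \max_(i < size (f`_j)%R | (f`_j`_i != 0)%R) (i + j)%N.

Definition curve_poly (R : realType) (m : nat) (phi : {poly R}) :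
  {poly {poly R}} := 'X^m - phi%:P.

(* For m > 0, curve_poly m phi is monic in y, so this is the quotient of
   R[x, y] by the ideal it generates; the class of f is
   in_qpoly (curve_poly m phi) f. *)
Definition curve_ring (R : realType) (m : nat) (phi : {poly R}) : Type :=
  {poly %/ curve_poly m phi}.

Definition curve_class (R : realType) (m : nat) (phi : {poly R})
    (f : {poly {poly R}}) : curve_ring m phi :=
  in_qpoly (curve_poly m phi) f.

Definition curve_eval (R : realType) (m : nat) (phi : {poly R})
    (f : curve_ring m phi) (x y : R) : R :=
  (val f).[y%:P].[x].

Lemma curve_eval_class (R : realType) (m : nat) (phi : {poly R})
    (f : {poly {poly R}}) (x y : R) :
  (0 < m)%N -> y ^+ m = phi.[x] ->
  curve_eval (curve_class m phi f) x y = f.[y%:P].[x].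
Proof.
move=> m0 yx; have sz : size (curve_poly m phi) = m.+1.
  by rewrite size_polyDl size_polyXn // size_polyN size_polyC; case: eqP.
have mo : curve_poly m phi \is monic.
  rewrite monicE lead_coefDl ?lead_coefXn // size_polyN size_polyXn size_polyC.
  by case: eqP.
rewrite /curve_eval /curve_class /= /mk_monic sz mo ltnS m0 /=.
rewrite [in RHS](Pdiv.RingMonic.rdivp_eq mo f) /curve_poly !(hornerD, hornerM, hornerN, hornerXn, hornerC).
by rewrite -rmorphXn /= hornerC yx subrr mulr0 add0r.
Qed.

Lemma curve_degree_subproof (R : realType) (m : nat) (phi : {poly R})
    (f : curve_ring m phi) :
  exists n, `[< exists g, curve_class m phi g = f /\ total_degree g = n >].
Proof.
exists (total_degree (val f)); apply/asboolP; exists (val f); split => //.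
apply: val_inj; exact: in_qpoly_small (size_mk_monic _).
Qed.

(* The lowest total degree of a representative; the zero class has degree 0. *)
Definition curve_degree (R : realType) (m : nat) (phi : {poly R})
    (f : curve_ring m phi) : nat :=
  ex_minn (curve_degree_subproof f).

Definition curve_ip (R : realType) (m : nat) (phi : {poly R}) (I : set R)
    (w : R -> R) (f g : curve_ring m phi) : R :=
  match m with
  | 1 => \int[@lebesgue_measure R]_(x in I)
      (curve_eval f x phi.[x] * curve_eval g x phi.[x] * w x)
  | 2 => \int[@lebesgue_measure R]_(x in I)
      ((curve_eval f x (Num.sqrt phi.[x]) * curve_eval g x (Num.sqrt phi.[x])
        + curve_eval f x (- Num.sqrt phi.[x])
          * curve_eval g x (- Num.sqrt phi.[x])) * w x)
  | _ => 0
  end.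

Definition OP_space (R : realType) (m : nat) (phi : {poly R}) (I : set R)
    (w : R -> R) (n : nat) : set (curve_ring m phi) :=
  [set f | (curve_degree f <= n)%N /\
     forall g : curve_ring m phi, (curve_degree g < n)%N ->
       curve_ip I w f g = 0].

Definition OP_dim (R : realType) (m : nat) (phi : {poly R}) (n : nat) : nat :=
  minn n.+1 (maxn (size phi).-1 m).

(* A real scalar c acts on the {poly R}-module curve_ring m phi as c%:P. *)
Record orthonormal_OP_basis (R : realType) (m : nat) (phi : {poly R})
    (I : set R) (w : R -> R) (Y : nat -> nat -> curve_ring m phi) : Prop :=
  OrthonormalOPBasis {
  OP_orthonormal : forall n k l i,
    (1 <= k <= OP_dim m phi n)%N -> (1 <= i <= OP_dim m phi l)%N ->
    curve_ip I w (Y n k) (Y l i) = ((n == l) && (k == i))%:R;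
  OP_degree : forall n k, (1 <= k <= OP_dim m phi n)%N ->
    curve_degree (Y n k) = n;
  OP_basis : forall (n : nat) (f : curve_ring m phi),
    OP_space I w n f <->
    exists c : nat -> R,
      f = \sum_(1 <= k < (OP_dim m phi n).+1)
            (c k)%:P *: (Y n k : {poly %/ curve_poly m phi})
}.

(* P^{(1,d)}_{n,0}, where p n stands for p_n(w; x). *)
Definition P1 (R : realType) (phi : {poly R}) (p : nat -> {poly R}) (n : nat) :
    curve_ring 1 phi :=
  curve_class 1 phi (p n)%:P.

(* P^{(2,d)}_{n,i} for i = 0, and for i = 1 when n >= 1; p n stands for
   p_n(w; x) and q n for p_n(phi w; x). *)
Definition P2 (R : realType) (phi : {poly R}) (p q : nat -> {poly R})
    (n i : nat) : curve_ring 2 phi :=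
  if i == 0%N
  then curve_class 2 phi ((Num.sqrt 2)^-1 *: p n)%:P
  else curve_class 2 phi ('X * ((Num.sqrt 2)^-1 *: q n.-1)%:P).

(* Main.v *)
Require Import Defs.
From HB Require Import structures.
From mathcomp Require Import all_boot all_order all_algebra.
From mathcomp Require Import all_classical all_reals all_analysis.
From mathcomp Require Import measurable_realfun zify ring.
Import Order.TTheory GRing.Theory Num.Theory.
Import numFieldNormedType.Exports.
Local Open Scope classical_set_scope.
Local Open Scope ring_scope.

(** Modulo [y ^ m = phi(x)] every class is uniquely a sum of terms
    [y ^ e * a(x)] with [e < m], and in these coordinates both structures on
    the coordinate ring split.

    The inner product: summing over the points above [x] removes the mixed
    terms, so the components [a] are paired separately, with weight [w] for
    [e = 0] and [phi * w] for [e = 1] ([curve_ipE]). The products of [y ^ e]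
    with orthonormal polynomials of these weights are thus orthonormal, up to
    the factor [m].

    The degree: the elements of degree at most [n] on the curve are spanned by
    the [y ^ e * x ^ i * phi ^ k] with [i + m * k + e <= n] ([curve_degree_ind]
    and [curve_degree_monomial]). A product [x ^ i * phi ^ k] has degree
    [D = i + d * k] in [x]; let [cost D] be the least [i + m * k] for a given
    [D]. If the cost is monotone, then by triangularity ([triangular_span])
    the products of cost at most [n] may be replaced by any polynomials of the
    same degrees, in particular by the orthonormal ones. So
    [y ^ e * p_D] has degree [cost D + e] on the curve, and the elements
    with [cost D + e = n] form an orthonormal basis of the space of orthogonal
    elements of degree [n] ([graded_basis_OP]). What remains is to list, for
    each [n], the pairs [(D, e)] with [cost D + e = n].

    For quartics the cost is monotone only on each parity class. When [phi] and
    [w] are even, the orthonormal polynomials have a definite parity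
    ([orthonormal_polys_parity]), and the triangular argument runs within each
    parity class. To have one argument for all cases, triangularity is stated
    for polynomials whose exponents lie in one class modulo [r], with [r = 2]
    for the quartics and [r = 1] otherwise. *)

(** * The moment functional of a weight *)

Definition weighted_int {R : realType} (I : set R) (w : R -> R)
    (f : {poly R}) : R :=
  \int[@lebesgue_measure R]_(x in I) (f.[x] * w x).

Definition finite_moments {R : realType} (I : set R) (w : R -> R) : Prop :=
  forall n, (@lebesgue_measure R).-integrable I (fun x => (x ^+ n * w x)%:E).

Section WeightedIntegral.
Variables (R : realType) (I : set R) (w : R -> R).
Hypotheses (mI : measurable I) (momw : finite_moments I w).

Lemma integrable_poly_weight (f : {poly R}) :
  (@lebesgue_measure R).-integrable I (fun x => (f.[x] * w x)%:E).
Proof.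
rewrite (_ : (fun x => _) = (fun x =>
    \sum_(i < size f) (f`_i)%:E * (x ^+ i * w x)%:E)%E).
  by apply: integrable_sum => // i _; exact: integrableZl.
apply/funext => x; rewrite horner_coef mulr_suml -sumEFin.
by apply: eq_bigr => i _; rewrite -EFinM mulrA.
Qed.

Lemma weighted_int_linear (c : R) (f g : {poly R}) :
  weighted_int I w (c *: f + g) = c * weighted_int I w f + weighted_int I w g.
Proof.
rewrite /weighted_int -RintegralZl//; last exact: integrable_poly_weight.
rewrite -RintegralD//; last exact: integrable_poly_weight.
- by apply: eq_Rintegral => x _; rewrite hornerD hornerZ mulrDl mulrA.
- have := integrable_poly_weight (c *: f).
  by congr (_.-integrable _ _); apply/funext => x; rewrite hornerZ /= mulrA.
Qed.

Lemma weighted_int0 : weighted_int I w 0 = 0.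
Proof.
have := weighted_int_linear (-1) 0 0.
by rewrite scaler0 addr0 mulN1r addNr.
Qed.

Lemma finite_moments_mul (phi : {poly R}) :
  finite_moments I (fun x => phi.[x] * w x).
Proof.
move=> n; have := integrable_poly_weight ('X^n * phi).
congr (_.-integrable _ _); apply/funext => x.
by rewrite hornerM hornerXn mulrA.
Qed.

Lemma weighted_int_mul (phi f : {poly R}) :
  weighted_int I (fun x => phi.[x] * w x) f = weighted_int I w (phi * f).
Proof.
by apply: eq_Rintegral => x _; rewrite hornerM mulrA [f.[x] * _]mulrC.
Qed.

End WeightedIntegral.

Lemma measurable_admissible {R : realType} (I : set R) :
  admissible_interval I -> measurable I.
Proof.
by case=> [[a [b [_ ->]]]|[a ->]|->]; [exact: measurable_itv..|exact: measurableT].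
Qed.

(** Lebesgue measure is its own image under negation, and the interval and
    the weight are symmetric: this is the change of variables formula for an
    image measure. *)
Lemma weighted_int_reflect {R : realType} (a : R) (w : R -> R) (f : {poly R}) :
  measurable_fun setT w -> finite_moments `]- a, a[ w ->
  (forall x, `]- a, a[%classic x -> w (- x) = w x) ->
  weighted_int `]- a, a[ w (f \Po - 'X) = weighted_int `]- a, a[ w f.
Proof.
move=> mw momw ew; set I := `]- a, a[%classic.
have mI : measurable I by exact: measurable_itv.
have eI : (-%R : _ -> measurableTypeR R) @^-1` I = I.
  by rewrite /I opp_preimage_itvbndbnd /= opprK.
have ef x : (f \Po - 'X).[x] = f.[- x] by rewrite horner_comp !hornerE.
pose g (x : R) : \bar R := (f.[x] * w x)%:E.
have mg : measurable_fun [set: R] g.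
  apply/measurable_EFinP; apply: measurable_funM => //.
  apply: continuous_measurable_fun; exact: continuous_horner.
have eg x : I x -> g (- x) = ((f \Po - 'X).[x] * w x)%:E.
  by move=> Ix; rewrite /g ef ew.
have ig : (@lebesgue_measure R).-integrable
    ((-%R : _ -> measurableTypeR R) @^-1` I) (g \o -%R).
  rewrite eI; apply: eq_integrable (integrable_poly_weight _ _ _ mI momw (f \Po - 'X)) => //.
  by move=> x /set_mem Ix /=; rewrite eg.
rewrite /weighted_int /Rintegral; congr fine.
have <- : (\int[@lebesgue_measure R]_(x in (-%R : _ -> measurableTypeR R) @^-1` I) (g \o -%R) x
   = \int[@lebesgue_measure R]_(x in I) ((f \Po - 'X).[x] * w x)%:E)%E.
  by rewrite eI; apply: eq_integral => x /set_mem Ix; rewrite /= eg.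
rewrite -integral_pushforward //.
by apply: eq_measure_integral => //= A mA AS; exact: lebesgue_measureN.
Qed.

(** * Triangular families of polynomials *)

(** Being a vector subspace over the reals, as a predicate, so that belonging
    to a span can be proved by closure rather than by exhibiting
    coefficients. *)
Definition linear_class {R : realType} (S : {poly R} -> Prop) : Prop :=
  S 0 /\ forall (c : R) f g, S f -> S g -> S (c *: f + g).

(** Exponents confined to one residue class: modulo 1 this says nothing, modulo
    2 it is a parity condition. Carrying the modulus as a parameter lets the
    symmetric quartic be treated together with the other curves. *)
Definition lacunary {R : realType} (r b : nat) (f : {poly R}) : Prop :=
  forall i, f`_i != 0 -> i = b %[mod r].

Section Lacunary.
Variables (R : realType) (r : nat).
Implicit Types f g : {poly R}.

Lemma lacunary_mul a b f g :
  lacunary r a f -> lacunary r b g -> lacunary r (a + b) (f * g).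
Proof.
move=> lf lg i; rewrite coefM => nz.
have [/existsP[j fgj]|] := boolP [exists j : 'I_i.+1, f`_j * g`_(i - j) != 0].
  move: fgj; rewrite mulf_eq0 negb_or => /andP[/lf fj /lg gj].
  by rewrite -(subnKC (ltn_ord j : (j <= i)%N)) -modnDm fj gj modnDm.
rewrite negb_exists => /forallP z; move: nz; rewrite big1 ?eqxx// => j _.
by apply/eqP; move: (z j); rewrite negbK.
Qed.

Lemma lacunary_Xn i : lacunary r i ('X^i : {poly R}).
Proof. by move=> j; rewrite coefXn; have [->//|_] := eqVneq j i; rewrite eqxx. Qed.

Lemma lacunary_exp f k : lacunary r 0 f -> lacunary r 0 (f ^+ k).
Proof.
move=> lf; elim: k => [|k IH]; first exact: (lacunary_Xn 0).
by rewrite exprS; exact: (@lacunary_mul 0 0).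
Qed.

Lemma lacunary_size n f : lacunary r 0 f -> size f = n.+1 -> n = 0 %[mod r].
Proof.
move=> lf sf; apply: lf; rewrite -[n]/(n.+1.-1) -sf -/(lead_coef f).
by rewrite lead_coef_eq0 -size_poly_eq0 sf.
Qed.

(** Leading terms are cancelled one after the other. A nonzero coefficient can
    only occur at a degree congruent to [b], and subtracting a multiple of the
    member of that degree keeps [f] lacunary; hence only the members whose
    degree is congruent to [b] are ever called for. *)
Lemma triangular_span (v : nat -> {poly R}) (S : {poly R} -> Prop) b n f :
  (forall k, size (v k) = k.+1) -> (forall k, lacunary r k (v k)) ->
  linear_class S ->
  (forall k, (k < n)%N -> k = b %[mod r] -> S (v k)) ->
  (size f <= n)%N -> lacunary r b f -> S f.
Proof.
move=> sv lv [S0 SD]; elim: n f => [|n IH] f Sv sf lf.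
  by move: sf; rewrite leqn0 size_poly_eq0 => /eqP ->.
have {}IH g := IH g (fun k kn => Sv k (ltnW kn)).
have [fn0|/eqP fn0] := eqVneq f`_n 0.
  apply: IH => //; apply/leq_sizeP => j; rewrite leq_eqVlt => /orP[/eqP<-//|nj].
  by move/leq_sizeP: sf; exact.
have nb : n = b %[mod r] by apply: lf; apply/eqP.
have vn0 : (v n)`_n != 0.
  by rewrite -[n in X in _`_X]/(n.+1.-1) -(sv n) -/(lead_coef _) lead_coef_eq0
             -size_poly_eq0 sv.
pose c := f`_n / (v n)`_n.
rewrite (_ : f = c *: v n + (f - c *: v n)); last by rewrite addrC subrK.
apply: SD; first exact: Sv.
apply: IH.
  apply/leq_sizeP => j; rewrite coefB coefZ leq_eqVlt => /orP[/eqP<-|nj].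
    by rewrite /c mulfVK // subrr.
  have /leq_sizeP -> // := sf; have /leq_sizeP -> // : (size (v n) <= n.+1)%N.
    by rewrite sv.
  by rewrite mulr0 subr0.
move=> j; rewrite coefB coefZ.
have [/eqP fj0|/lf//] := boolP (f`_j == 0).
rewrite fj0 sub0r oppr_eq0 mulf_eq0 negb_or => /andP[_ /lv ->].
exact: nb.
Qed.

End Lacunary.

Lemma lacunary1 {R : realType} b (f : {poly R}) : lacunary 1 b f.
Proof. by move=> i _; rewrite !modn1. Qed.

(** * Orthonormal polynomials and their parity *)

Section Orthonormal.
Variables (R : realType) (I : set R) (w : R -> R) (p : nat -> {poly R}).
Hypotheses (mI : measurable I) (momw : finite_moments I w).
Hypothesis (op : orthonormal_polys I w p).

Let L := weighted_int I w.

Lemma orthonormal_polysE n k : L (p n * p k) = (n == k)%:R.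
Proof.
by rewrite -op.2; apply: eq_Rintegral => x _; rewrite hornerM.
Qed.

Lemma orthonormal_expansion n (f : {poly R}) : (size f <= n)%N ->
  exists c : nat -> R, f = \sum_(k < n) c k *: p k.
Proof.
move=> sf.
pose S (f : {poly R}) := exists c : nat -> R, f = \sum_(k < n) c k *: p k.
apply: (@triangular_span _ 1 p S 0 n f _ _ _ _ sf).
- exact: op.1.
- by move=> k i _; rewrite !modn1.
- split=> [|c g h [cg ->] [ch ->]].
    by exists (fun=> 0); rewrite big1 // => i _; rewrite scale0r.
  exists (fun k => c * cg k + ch k); rewrite scaler_sumr -big_split /=.
  by apply: eq_bigr => i _; rewrite scalerDl scalerA.
- move=> k kn _; exists (fun j => (j == k)%:R).
  rewrite (bigD1 (Ordinal kn)) //= eqxx scale1r big1 ?addr0 // => j /eqP jk.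
  by case: eqP => [e|]; [case: jk; exact: val_inj | rewrite scale0r].
- by move=> i; rewrite !modn1.
Qed.

Lemma weighted_int_sum n (c : nat -> R) (g : {poly R}) (u : nat -> {poly R}) :
  L ((\sum_(k < n) c k *: u k) * g) = \sum_(k < n) c k * L (u k * g).
Proof.
elim: n => [|n IH]; first by rewrite !big_ord0 mul0r; exact: weighted_int0.
rewrite !big_ord_recr /= mulrDl [in LHS]addrC -scalerAl /L weighted_int_linear //.
by rewrite -/L IH addrC.
Qed.

Lemma orthonormal_coef n (c : nat -> R) k : (k < n)%N ->
  L ((\sum_(j < n) c j *: p j) * p k) = c k.
Proof.
move=> kn; rewrite weighted_int_sum (bigD1 (Ordinal kn)) //= orthonormal_polysE.
rewrite eqxx mulr1 big1 ?addr0 // => j /eqP jk; rewrite orthonormal_polysE.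
by case: eqP => [e|]; [case: jk; exact: val_inj | rewrite mulr0].
Qed.

Lemma orthonormal_lower n (f : {poly R}) : (size f <= n)%N -> L (p n * f) = 0.
Proof.
move=> /orthonormal_expansion[c ->]; rewrite mulrC weighted_int_sum big1 // => k _.
by rewrite orthonormal_polysE; case: eqP (ltn_ord k) => [->|]; rewrite ?ltnn ?mulr0.
Qed.

Lemma orthogonal_lower_eq0 n (f : {poly R}) : (size f <= n)%N ->
  (forall k, (k < n)%N -> L (f * p k) = 0) -> f = 0.
Proof.
move=> /orthonormal_expansion[c ->] z; rewrite big1 // => k _.
by rewrite -(orthonormal_coef n c k (ltn_ord k)) z ?scale0r.
Qed.

End Orthonormal.

Lemma coef_comp_polyNX {R : realType} (f : {poly R}) i :
  (f \Po - 'X)`_i = (-1) ^+ i * f`_i.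
Proof.
rewrite coef_comp_poly; under eq_bigr do
  rewrite -scaleN1r exprZn coefZ coefXn.
have [fi|fi] := ltnP i (size f).
  rewrite (bigD1 (Ordinal fi)) //= eqxx mulr1 mulrC big1 ?addr0 // => j /eqP ji.
  by case: eqP => [e|]; [case: ji; exact: val_inj | rewrite !mulr0].
rewrite nth_default // mulr0 big1 // => j _.
by case: eqP (ltn_ord j) => [<-|]; rewrite ?ltnNge ?fi ?mulr0.
Qed.

Lemma lacunary_comp_polyNX {R : realType} (f : {poly R}) n :
  f \Po - 'X = (-1) ^+ n *: f -> lacunary 2 n f.
Proof.
move=> ef i nz; have := congr1 (fun g : {poly R} => g`_i) ef.
rewrite coef_comp_polyNX coefZ => /(mulIf nz) => e.
by rewrite !modn2; congr (nat_of_bool _); apply: (@signr_inj R); rewrite !signr_odd.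
Qed.

Lemma even_lacunary {R : realType} (phi : {poly R}) :
  (forall x, phi.[- x] = phi.[x]) -> lacunary 2 0 phi.
Proof.
move=> ephi; apply: lacunary_comp_polyNX; rewrite expr0 scale1r.
apply/eqP; rewrite -subr_eq0; apply/eqP.
set f := _ - _; apply/eqP; apply: contraT => f0.
(* A nonzero polynomial cannot have as many roots as its size. *)
pose s := [seq k%:R : R | k <- iota 0 (size f)].
have := @max_poly_roots R f s f0; rewrite size_map size_iota ltnn; apply.
  apply/allP => _ /mapP[k _ ->]; rewrite /root /f hornerD hornerN horner_comp.
  by rewrite hornerN hornerX ephi subrr.
by rewrite map_inj_uniq ?iota_uniq // => i j /eqP; rewrite eqr_nat => /eqP.
Qed.

Section Parity.
Variables (R : realType) (a : R) (w : R -> R) (p : nat -> {poly R}).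
Let I := `]- a, a[%classic.
Hypotheses (mw : measurable_fun setT w) (momw : finite_moments I w).
Hypotheses (ew : forall x, I x -> w (- x) = w x) (op : orthonormal_polys I w p).

(** The difference of the two sides has degree less than [n], because the
    leading terms cancel, and by reflection it is orthogonal to every
    polynomial of degree less than [n]. *)
Lemma orthonormal_polys_parity n : p n \Po - 'X = (-1) ^+ n *: p n.
Proof.
have mI : measurable I by exact: measurable_itv.
have sN (f : {poly R}) m : (size f <= m)%N -> (size (f \Po - 'X) <= m)%N.
  move=> /leq_sizeP sf; apply/leq_sizeP => j mj.
  by rewrite coef_comp_polyNX sf ?mulr0.
apply/eqP; rewrite -subr_eq0; apply/eqP.
apply: (@orthogonal_lower_eq0 _ I w p mI momw op n) => [|k kn].
  have sn := op.1 n; apply/leq_sizeP => j.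
  rewrite coefB coefZ coef_comp_polyNX leq_eqVlt => /orP[/eqP<-|nj].
    by rewrite subrr.
  by rewrite nth_default ?mulr0 ?subr0 // sn.
rewrite mulrBl addrC -scalerAl -scaleNr weighted_int_linear //.
rewrite orthonormal_polysE // gtn_eqF // mulr0 add0r.
rewrite -(weighted_int_reflect a w _ mw momw ew) comp_polyM -comp_polyA.
have -> : (- 'X : {poly R}) \Po - 'X = 'X by rewrite raddfN /= comp_polyX opprK.
rewrite comp_polyXr; apply: orthonormal_lower => //.
by apply: sN; rewrite op.1.
Qed.

End Parity.

(** * The coordinate ring and its degree filtration *)

Section CurveRing.
Variables (R : realType) (m : nat) (phi : {poly R}).
Hypothesis m0 : (0 < m)%N.

Let h := curve_poly m phi.

Lemma size_curve_poly : size h = m.+1.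
Proof. by rewrite size_polyDl size_polyXn // size_polyN size_polyC; case: eqP. Qed.

Lemma mk_monic_curve_poly : mk_monic h = h.
Proof.
rewrite /mk_monic size_curve_poly ltnS m0 /= monicE lead_coefDl.
  by rewrite lead_coefXn eqxx.
by rewrite size_polyN size_polyXn size_polyC; case: eqP.
Qed.

(** The class of [y ^ e * a(x)]; for [e < m] these are the components of the
    unique representatives of degree less than [m] in [y]. *)
Definition ymonom (e : nat) (a : {poly R}) : {poly %/ curve_poly m phi} :=
  curve_class m phi ('X^e * a%:P).

Lemma ymonom_linear e (c : R) (a b : {poly R}) :
  ymonom e (c *: a + b) = c%:P *: ymonom e a + ymonom e b.
Proof.
rewrite /ymonom /curve_class -in_qpolyZ -in_qpolyD; congr in_qpoly.
by rewrite polyCD -[c *: a]mul_polyC polyCM mulrDr mulrCA mul_polyC.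
Qed.

Lemma ymonom0 e : ymonom e 0 = 0.
Proof. by rewrite /ymonom polyC0 mulr0 /curve_class in_qpoly0. Qed.

Lemma ymonom_reduce e k (a : {poly R}) :
  ymonom (e + m * k) a = ymonom e (a * phi ^+ k).
Proof.
have eX : in_qpoly h 'X^m = in_qpoly h phi%:P.
  apply/eqP; rewrite -subr_eq0 -[_ - _]raddfB -/(curve_poly m phi) -/h.
  have hm := monic_mk_monic h; rewrite mk_monic_curve_poly in hm.
  by apply/eqP/val_inj; rewrite /= mk_monic_curve_poly Pdiv.RingMonic.rmodpp.
rewrite /ymonom /curve_class exprD exprM -mulrA !in_qpolyM; congr (_ * _).
by rewrite rmorphXn /= eX -rmorphXn -in_qpolyM -rmorphXn -polyCM mulrC.
Qed.

Lemma coef_ymonom e (a : {poly R}) j : (e < m)%N ->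
  (val (ymonom e a))`_j = if j == e then a else 0.
Proof.
move=> em; rewrite /ymonom /curve_class [val _]in_qpoly_small; last first.
  rewrite mk_monic_curve_poly size_curve_poly mulrC mul_polyC ltnS.
  by apply: leq_trans (size_scale_leq _ _) _; rewrite size_polyXn.
by rewrite mulrC coefCM coefXn; case: eqP => _; rewrite ?mulr1 ?mulr0.
Qed.

Lemma total_degree_leP (g : {poly {poly R}}) n :
  (total_degree g <= n)%N <-> forall j i, g`_j`_i != 0 -> (i + j <= n)%N.
Proof.
split=> [/bigmax_leqP le j i nz|le].
  have js : (j < size g)%N.
    by rewrite ltnNge; apply: contra nz => /leq_sizeP ->//; rewrite coef0.
  have is_ : (i < size (g`_j)%R)%N.
    by rewrite ltnNge; apply: contra nz => /leq_sizeP ->.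
  have /bigmax_leqP le2 := le (Ordinal js) isT.
  exact: (le2 (Ordinal is_) nz).
apply/bigmax_leqP => j _; apply/bigmax_leqP => i nz; exact: le.
Qed.

Lemma curve_degree_leP (f : curve_ring m phi) n :
  (curve_degree f <= n)%N <->
  exists g, curve_class m phi g = f /\
    forall j i, g`_j`_i != 0 -> (i + j <= n)%N.
Proof.
rewrite /curve_degree; case: ex_minnP => d /asboolP[g [gf gd]] dmin.
split=> [dn|[g' [gf' /total_degree_leP gn]]].
  by exists g; split => //; apply/total_degree_leP; rewrite gd.
by apply: leq_trans gn; apply: dmin; apply/asboolP; exists g'.
Qed.

Definition curve_linear_class (S : curve_ring m phi -> Prop) : Prop :=
  S (0 : {poly %/ h}) /\ forall (c : R) (f g : {poly %/ h}), S f -> S g ->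
    S (c%:P *: f + g).

Lemma linear_class_ymonom S e : curve_linear_class S ->
  linear_class (fun a => S (ymonom e a)).
Proof.
move=> [S0 SD]; split=> [|c a b Sa Sb]; first by rewrite ymonom0.
by rewrite ymonom_linear; apply: SD.
Qed.

Lemma curve_degree_linear_class n :
  curve_linear_class (fun f => curve_degree f <= n)%N.
Proof.
split=> [|c _ _ /curve_degree_leP[f [<- lf]] /curve_degree_leP[g [<- lg]]].
  apply/curve_degree_leP; exists 0; split; first exact: in_qpoly0.
  by move=> j i; rewrite !coef0 eqxx.
apply/curve_degree_leP; exists (c%:P *: f + g); split.
  by rewrite /curve_class in_qpolyD in_qpolyZ.
move=> j i; rewrite coefD coefZ coefD coefCM.
have [/eqP f0|/lf//] := boolP (f`_j`_i == 0).
by rewrite f0 mulr0 add0r; exact: lg.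
Qed.

(** The representative [x ^ i * y ^ (e + m * k)] is used: trading each factor
    [phi] for [y ^ m] costs [m] instead of the degree of [phi]. *)
Lemma curve_degree_monomial i k e :
  (curve_degree (ymonom e ('X^i * phi ^+ k)) <= i + m * k + e)%N.
Proof.
apply/curve_degree_leP; exists ('X^(e + m * k) * ('X^i)%:P); split.
  by rewrite -ymonom_reduce.
move=> j l; rewrite mulrC coefCM coefXn.
have [->|_] := eqVneq j (e + m * k)%N; last by rewrite mulr0 coef0 eqxx.
by rewrite mulr1 coefXn; have [->|_] := eqVneq l i; rewrite ?eqxx //; lia.
Qed.

(** Reducing the powers of [y] in a representative of degree at most [n], one
    sees that the elements of degree at most [n] are spanned by the products
    [y ^ e * x ^ i * phi ^ k] that occur in the hypothesis. *)
Lemma curve_degree_ind n (S : curve_ring m phi -> Prop) :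
  curve_linear_class S ->
  (forall i k e, (e < m)%N -> (i + m * k + e <= n)%N ->
    S (ymonom e ('X^i * phi ^+ k))) ->
  forall f, (curve_degree f <= n)%N -> S f.
Proof.
move=> lS Sm _ /curve_degree_leP[g [<- lg]].
have [S0 SD] := lS.
rewrite -[g]coefK poly_def /curve_class raddf_sum /=.
apply: (@big_ind _ S) => // [f1 f2 S1 S2|j _].
  by rewrite -[f1]scale1r; exact: (SD 1).
have {lS} [S'0 S'D] := linear_class_ymonom S j lS.
rewrite -mul_polyC mulrC -/(curve_class m phi _) -/(ymonom j _).
rewrite -[g`_j]coefK poly_def.
apply: (@big_ind _ (fun a => S (ymonom j a))) => // [f1 f2 S1 S2|i _].
  by rewrite -[f1]scale1r; exact: S'D.
rewrite -[_ *: _]addr0; have [->|/lg ij] := eqVneq g`_j`_i 0.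
  by rewrite scale0r addr0.
apply: S'D => //; have jE : (j %% m + m * (j %/ m) = j)%N by rewrite addnC mulnC -divn_eq.
have -> : ymonom j 'X^i = ymonom (j %% m) ('X^i * phi ^+ (j %/ m)).
  by rewrite -ymonom_reduce jE.
by apply: Sm; rewrite ?ltn_pmod // -addnA [(_ * _ + _)%N]addnC jE.
Qed.

End CurveRing.

(** * The inner product on the curve *)

Section InnerProduct.
Variables (R : realType) (m : nat) (phi : {poly R}) (I : set R) (w : R -> R).
Hypotheses (m12 : m = 1%N \/ m = 2%N) (mI : measurable I).
Hypotheses (momw : finite_moments I w).
Hypothesis phi0 : m = 2%N -> forall x, I x -> 0 < phi.[x].

(** The sum over the [m] points [(x, y)] above [x] kills the mixed products of
    different powers of [y], so the components of the normal forms are paired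
    separately, the [e]-th ones against the weight [phi ^ e * w]. *)
Lemma curve_ipE (f g : {poly %/ curve_poly m phi}) :
  curve_ip I w f g = weighted_int I w
    (m%:R *: \sum_(e < m) phi ^+ e * ((val f)`_e * (val g)`_e)).
Proof.
have m0 : (0 < m)%N by case: m12 => ->.
have ev (u : curve_ring m phi) x y :
    curve_eval u x y = \sum_(e < m) ((val u)`_e).[x] * y ^+ e.
  rewrite /curve_eval [_.[y%:P]](@horner_coef_wide _ m); last first.
    rewrite -ltnS; apply: leq_trans (size_mk_monic u) _.
    by rewrite mk_monic_curve_poly // size_curve_poly.
  rewrite horner_sum; apply: eq_bigr => e _.
  by rewrite hornerM -rmorphXn /= hornerC.
case: m12 (phi0) ev f g => {m0} -> phi_gt0 ev f g; apply: eq_Rintegral => x /set_mem Ix.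
  by rewrite !ev scale1r !big_ord1 !mulr1 mul1r hornerM.
have sq : Num.sqrt phi.[x] ^+ 2 = phi.[x] by rewrite sqr_sqrtr// ltW// phi_gt0.
rewrite !ev !big_ord_recl !big_ord0 /= /bump /= !hornerE /=.
by set s := Num.sqrt _ in sq *; rewrite -sq; ring.
Qed.

Lemma curve_ip_linear (c : R) (f g k : {poly %/ curve_poly m phi}) :
  curve_ip I w (c%:P *: f + g) k = c * curve_ip I w f k + curve_ip I w g k.
Proof.
rewrite !curve_ipE -weighted_int_linear //; congr weighted_int.
rewrite scalerA mulrC -scalerA -scalerDr; congr (_ *: _).
rewrite scaler_sumr -big_split /=; apply: eq_bigr => e _.
rewrite coefD coefZ mul_polyC mulrDl mulrDr.
by rewrite -scalerAl -scalerAr.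
Qed.

Lemma curve_ipC (f g : {poly %/ curve_poly m phi}) :
  curve_ip I w f g = curve_ip I w g f.
Proof.
rewrite !curve_ipE; congr weighted_int; congr (_ *: _).
by apply: eq_bigr => e _; rewrite [(val f)`_e * _]mulrC.
Qed.

Lemma curve_ip0 (g : {poly %/ curve_poly m phi}) :
  curve_ip I w (0 : {poly %/ curve_poly m phi}) g = 0.
Proof.
have := curve_ip_linear (-1) 0 0 g.
by rewrite scaler0 addr0 mulN1r addNr.
Qed.

Lemma curve_ip_sum (J : Type) (s : seq J) (c : J -> R)
    (F : J -> {poly %/ curve_poly m phi}) g :
  curve_ip I w (\sum_(j <- s) (c j)%:P *: F j) g =
  \sum_(j <- s) c j * curve_ip I w (F j) g.
Proof.
elim: s => [|j s IH]; first by rewrite !big_nil curve_ip0.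
by rewrite !big_cons curve_ip_linear IH.
Qed.

Lemma curve_ip_ymonom (e e' : nat) (a b : {poly R}) :
  (e < m)%N -> (e' < m)%N ->
  curve_ip I w (ymonom R m phi e a) (ymonom R m phi e' b) =
  if e == e' then weighted_int I w (m%:R *: (phi ^+ e * (a * b))) else 0.
Proof.
have m0 : (0 < m)%N by case: m12 => ->.
move=> em em'; rewrite curve_ipE.
under eq_bigr do rewrite !coef_ymonom //.
rewrite (bigD1 (Ordinal em)) //= eqxx big1 ?addr0.
  case: ifP => // _; rewrite !mulr0 scaler0.
  by apply: weighted_int0.
move=> i /eqP ie; case: eqP => [e0|_]; last by rewrite mul0r mulr0.
by case: ie; apply: val_inj.
Qed.

End InnerProduct.

(** * From one-variable orthonormal polynomials to the curve *)

Section GradedBasis.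
Variables (R : realType) (m d r : nat) (phi : {poly R}) (I : set R) (w : R -> R).
Hypotheses (m12 : m = 1%N \/ m = 2%N) (mI : measurable I).
Hypotheses (momw : finite_moments I w).
Hypothesis phi_gt0 : m = 2%N -> forall x, I x -> 0 < phi.[x].
Hypotheses (sphi : size phi = d.+1) (lphi : lacunary r 0 phi).

(* [cost D] is the least degree on the curve of a product [x ^ i * phi ^ k] of
   degree [D] in [x]. *)
Variable cost : nat -> nat.
Hypothesis cost_mono :
  forall k l, (k <= l)%N -> k = l %[mod r] -> (cost k <= cost l)%N.
Hypothesis cost_le : forall i k, (cost (i + d * k) <= i + m * k)%N.
Hypothesis cost_attained :
  forall D, exists i k, D = (i + d * k)%N /\ cost D = (i + m * k)%N.

(* The normalizing constant is part of [u]; [y ^ e * u e D] is the candidate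
   basis element indexed by the pair [(D, e)]. *)
Variable u : nat -> nat -> {poly R}.
Hypothesis size_u : forall e D, (e < m)%N -> size (u e D) = D.+1.
Hypothesis lac_u : forall e D, (e < m)%N -> lacunary r D (u e D).
Hypothesis orth_u : forall e D D', (e < m)%N ->
  weighted_int I w (m%:R *: (phi ^+ e * (u e D * u e D'))) = (D == D')%:R.

(* [sigma n] lists the indices of the candidates of degree [n], in the order in
   which they are numbered by [Y n]. *)
Variable sigma : nat -> seq (nat * nat).
Hypothesis sigma_uniq : forall n, uniq (sigma n).
Hypothesis sigma_size : forall n, size (sigma n) = OP_dim m phi n.
Hypothesis mem_sigma : forall n D e,
  ((D, e) \in sigma n) = (e < m)%N && (cost D + e == n)%N.

Variable Y : nat -> nat -> curve_ring m phi.
Hypothesis YE : forall n k, (k < size (sigma n))%N ->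
  Y n k.+1 = let: (D, e) := nth (0%N, 0%N) (sigma n) k in ymonom R m phi e (u e D).

Let m0 : (0 < m)%N. Proof. by case: m12 => ->. Qed.

Let size_mon i k : size ('X^i * phi ^+ k) = (i + d * k).+1.
Proof.
have phin : phi != 0 by rewrite -size_poly_eq0 sphi.
have sk : size (phi ^+ k) = (d * k).+1.
  by rewrite -[LHS]prednK ?size_exp ?sphi // size_poly_gt0 expf_neq0.
by rewrite size_monicM ?monicXn ?expf_neq0 // size_polyXn sk /= addnS.
Qed.

Let d_mod : d = 0 %[mod r].
Proof. exact: lacunary_size lphi sphi. Qed.

Let lac_mon i k : lacunary r (i + d * k) ('X^i * phi ^+ k).
Proof.
move=> j /(@lacunary_mul _ _ i 0 _ _ (@lacunary_Xn R r i) (lacunary_exp _ _ _ k lphi)) ->.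
by rewrite -[RHS]modnDmr -modnMml d_mod mod0n mul0n mod0n.
Qed.

Let E (x : nat * nat) : {poly %/ curve_poly m phi} :=
  ymonom R m phi x.2 (u x.2 x.1).

Let deg (x : nat * nat) := (cost x.1 + x.2)%N.

(* A triangular expansion of [u e D] in the cheapest products of each degree;
   [cost_mono] bounds all the costs that occur. *)
Let E_degree x : (x.2 < m)%N -> (curve_degree (E x : curve_ring m phi) <= deg x)%N.
Proof.
case: x => D e /= em; rewrite /E /deg /=.
have /choice[i /choice[k ik]] := cost_attained.
pose v D := 'X^(i D) * phi ^+ (k D).
apply: (@triangular_span _ r v
  (fun a => curve_degree (ymonom R m phi e a : curve_ring m phi) <= cost D + e)%N
  D D.+1 (u e D)).
- by move=> l; rewrite size_mon -(ik l).1.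
- by move=> l j /lac_mon ->; rewrite -(ik l).1.
- exact: linear_class_ymonom (curve_degree_linear_class R m phi _).
- move=> l lD lr; apply: leq_trans (curve_degree_monomial _ _ _ _ _ _ _) _ => //.
  by rewrite leq_add2r -(ik l).2; exact: cost_mono.
- by rewrite size_u.
- exact: lac_u.
Qed.

(* The converse expansion, of the products in the [u e D]: together with
   [E_degree], the candidates of index of cost at most [n] span exactly the
   elements of degree at most [n]. *)
Let E_ind n (S : curve_ring m phi -> Prop) :
  curve_linear_class R m phi S ->
  (forall x, (x.2 < m)%N -> (deg x <= n)%N -> S (E x)) ->
  forall f, (curve_degree f <= n)%N -> S f.
Proof.
move=> lS SE; apply: curve_degree_ind => // i k e em len.
apply: (@triangular_span _ r (u e) (fun a => S (ymonom R m phi e a))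
  (i + d * k) (i + d * k).+1).
- by move=> D; exact: size_u.
- by move=> D; exact: lac_u.
- exact: linear_class_ymonom.
- move=> D le Dr; apply: (SE (D, e)) => //; apply: leq_trans len.
  by rewrite leq_add2r; apply: leq_trans (cost_le i k); exact: cost_mono.
- by rewrite size_mon.
- exact: lac_mon.
Qed.

Let ip (f g : {poly %/ curve_poly m phi}) := curve_ip I w f g.

Let E_orthonormal x y : (x.2 < m)%N -> (y.2 < m)%N ->
  ip (E x) (E y) = (x == y)%:R.
Proof.
case: x y => [D e] [D' e'] /= em em'; rewrite /ip curve_ip_ymonom //=.
rewrite xpair_eqE; have [<-|_] := eqVneq e e'; last by rewrite andbF.
by rewrite andbT orth_u.
Qed.

Let mem_sigmaE n x : (x \in sigma n) = (x.2 < m)%N && (deg x == n).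
Proof. by case: x => D e; rewrite mem_sigma. Qed.

(* Both sides are linear in [f] and agree on the candidates. *)
Let fourier n (f : {poly %/ curve_poly m phi}) :
  (curve_degree (f : curve_ring m phi) <= n)%N ->
  f = \sum_(l < n.+1) \sum_(x <- sigma l) (ip f (E x))%:P *: E x.
Proof.
apply: (@E_ind n (fun f : {poly %/ curve_poly m phi} =>
  f = \sum_(l < n.+1) \sum_(x <- sigma l) (ip f (E x))%:P *: E x)).
  split=> [|c g h {1}-> {1}->].
    rewrite big1 // => l _; rewrite big1_seq // => x _.
    by rewrite /ip curve_ip0 // scale0r.
  rewrite scaler_sumr -big_split /=; apply: eq_bigr => l _.
  rewrite scaler_sumr -big_split /=; apply: eq_bigr => x _.
  by rewrite scalerA -scalerDl -polyCM -polyCD /ip curve_ip_linear.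
move=> y ym yn.
rewrite (bigD1 (Ordinal (yn : (deg y < n.+1)%N))) //= [X in _ + X]big1 ?addr0 => [|l /eqP yl].
  have ys : y \in sigma (deg y) by rewrite mem_sigmaE ym eqxx.
  rewrite (bigD1_seq y) //= E_orthonormal // eqxx scale1r big1_seq ?addr0 //.
  move=> x /andP[xy]; rewrite mem_sigmaE => /andP[xm _].
  by rewrite E_orthonormal // eq_sym (negPf xy) scale0r.
rewrite big1_seq // => x /andP[_]; rewrite mem_sigmaE => /andP[xm /eqP xl].
rewrite E_orthonormal //; case: eqP => [yx|]; last by rewrite scale0r.
by case: yl; apply: val_inj; rewrite /= yx xl.
Qed.

Let E_orthogonal x (g : {poly %/ curve_poly m phi}) : (x.2 < m)%N ->
  (curve_degree (g : curve_ring m phi) < deg x)%N -> ip (E x) g = 0.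
Proof.
move=> xm; case dx: (deg x) => [|n] // gn; rewrite /ip curve_ipC //.
apply: (@E_ind n (fun f : {poly %/ curve_poly m phi} => ip f (E x) = 0)) => //.
  split=> [|c g1 g2 g10 g20]; first by rewrite /ip curve_ip0.
  by rewrite /ip curve_ip_linear // [curve_ip _ _ g1 _]g10
    [curve_ip _ _ g2 _]g20 mulr0 addr0.
move=> y ym yn; rewrite E_orthonormal //; case: eqP => // yx.
by move: yn; rewrite yx dx ltnn.
Qed.

Let YnE n k : (1 <= k <= OP_dim m phi n)%N ->
  [/\ Y n k = E (nth (0%N, 0%N) (sigma n) k.-1),
      (k.-1 < size (sigma n))%N,
      (nth (0%N, 0%N) (sigma n) k.-1).2 < m &
      deg (nth (0%N, 0%N) (sigma n) k.-1) = n]%N.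
Proof.
case: k => [|k] //=; rewrite -sigma_size => kn.
have := mem_nth (0%N, 0%N) kn; rewrite mem_sigmaE => /andP[nm /eqP dn].
by split => //; rewrite YE // /E; case: (nth _ _ _).
Qed.

(** In the expansion of an element of degree at most [n] along the candidates,
    orthogonality to all lower degrees removes the terms of degree less than
    [n]. A candidate cannot have a degree below its cost, as it would then be
    orthogonal to itself. *)
Theorem graded_basis_OP : orthonormal_OP_basis I w Y.
Proof.
have sumY n (c : nat * nat -> R) : exists c' : nat -> R,
  \sum_(x <- sigma n) (c x)%:P *: E x =
  \sum_(1 <= k < (OP_dim m phi n).+1) (c' k)%:P *: (Y n k : {poly %/ _}).
  exists (fun k => c (nth (0%N, 0%N) (sigma n) k.-1)).
  rewrite (big_nth (0%N, 0%N)) big_add1 -sigma_size /=.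
  rewrite !big_seq; apply: eq_bigr => k; rewrite mem_index_iota => /andP[_ kn].
  by rewrite YE // /E; case: (nth _ _ _).
split.
- move=> n k l i nk li.
  have [-> ks km kd] := YnE n k nk; have [-> il im id] := YnE l i li.
  rewrite [LHS]E_orthonormal //; congr (nat_of_bool _)%:R.
  apply/eqP/andP => [e|[/eqP nl /eqP ki]]; last by rewrite nl ki.
  have nl : n = l by rewrite -kd -id e.
  subst l; rewrite eqxx; split => //.
  move/eqP: e; rewrite nth_uniq // => /eqP.
  by move: nk li => /andP[k0 _] /andP[i0 _]; lia.
- move=> n k nk; have [-> ks km kd] := YnE n k nk.
  have := E_degree _ km; rewrite kd leq_eqVlt => /orP[/eqP //|lt].
  have := E_orthogonal _ _ km; rewrite kd => /(_ _ lt).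
  by rewrite E_orthonormal // eqxx => /eqP; rewrite oner_eq0.
- move=> n f; split=> [[fn fo]|[c ->]].
    have [c' cE] := sumY n (fun x => ip f (E x)).
    exists c'; rewrite -cE {1}(fourier n f fn) big_ord_recr /= big1 ?add0r // => l _.
    rewrite big1_seq // => x /andP[_]; rewrite mem_sigmaE => /andP[xm /eqP xl].
    rewrite /ip fo ?scale0r //.
    by apply: leq_ltn_trans (E_degree _ xm) _; rewrite xl.
  have [S0 SD] := curve_degree_linear_class R m phi n.
  split.
    rewrite big_seq; apply: (@big_ind _ (fun f : {poly %/ curve_poly m phi} =>
      curve_degree (f : curve_ring m phi) <= n)%N) => // [f1 f2 d1 d2|k].
      by rewrite -[f1]scale1r; exact: (SD 1).
    rewrite mem_index_iota ltnS => nk; rewrite -[_ *: _]addr0; apply: SD => //.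
    have [-> _ km kd] := YnE n k nk; by have := E_degree _ km; rewrite kd.
  move=> g gn; rewrite curve_ip_sum // big1_seq // => k /andP[_].
  rewrite mem_index_iota ltnS => nk; have [-> _ km kd] := YnE n k nk.
  by rewrite [curve_ip _ _ _ _]E_orthogonal ?mulr0 // kd.
Qed.

End GradedBasis.

Section CurveBases.
Variables (R : realType) (I : set R) (w : R -> R) (phi : {poly R}).
Variable p : nat -> {poly R}.
Hypotheses (mI : measurable I) (momw : finite_moments I w).
Hypothesis hp : orthonormal_polys I w p.

(** For [m = 1] there is a single power of [y], and the pairs in [sigma] have
    second component 0. *)
Lemma graded_basis_OP1 (d : nat) (cost : nat -> nat)
    (sigma : nat -> seq (nat * nat)) (Y : nat -> nat -> curve_ring 1 phi) :
  size phi = d.+1 ->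
  (forall k l, (k <= l)%N -> (cost k <= cost l)%N) ->
  (forall i k, (cost (i + d * k) <= i + k)%N) ->
  (forall D, exists i k, D = (i + d * k)%N /\ cost D = (i + k)%N) ->
  (forall n, uniq (sigma n)) ->
  (forall n, size (sigma n) = OP_dim 1 phi n) ->
  (forall n D e, ((D, e) \in sigma n) = (e < 1)%N && (cost D + e == n)%N) ->
  (forall n k, (k < size (sigma n))%N ->
    Y n k.+1 = P1 phi p (nth (0, 0) (sigma n) k).1)%N ->
  orthonormal_OP_basis I w Y.
Proof.
move=> sphi cm cl ca su ss ms YE.
apply: (@graded_basis_OP R 1 d 1 phi I w _ mI momw _ sphi (@lacunary1 R 0 phi)
  cost _ _ _ (fun _ => p) _ _ _ sigma su ss ms) => //.
- by left.
- by move=> k l kl _; exact: cm.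
- by move=> i k; rewrite mul1n.
- by move=> D; have [i [k ik]] := ca D; exists i, k; rewrite mul1n.
- by move=> e D _; rewrite hp.1.
- by move=> e D _; exact: lacunary1.
- case=> // D D' _; rewrite scale1r mul1r.
  exact: orthonormal_polysE.
- move=> n k kn; rewrite YE //; have := mem_nth (0%N, 0%N) kn.
  case: (nth _ _ _) => D [|e]; rewrite ms // => _.
  by rewrite /P1 /ymonom expr0 mul1r.
Qed.

Section TwoSheets.
Variable q : nat -> {poly R}.
Hypothesis phi_gt0 : forall x, I x -> 0 < phi.[x].
Hypothesis hq : orthonormal_polys I (fun x => phi.[x] * w x) q.

(** The factor 2 in the inner product, coming from the two points above each
    [x], is absorbed by the factors [1 / sqrt 2]. The element numbered [n] in
    the second family involves [q] of index [n - 1], whence the index [D + e]. *)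
Lemma graded_basis_OP2 (d r : nat) (cost : nat -> nat)
    (sigma : nat -> seq (nat * nat)) (Y : nat -> nat -> curve_ring 2 phi) :
  size phi = d.+1 -> lacunary r 0 phi ->
  (forall n, lacunary r n (p n)) -> (forall n, lacunary r n (q n)) ->
  (forall k l, (k <= l)%N -> k = l %[mod r] -> (cost k <= cost l)%N) ->
  (forall i k, (cost (i + d * k) <= i + 2 * k)%N) ->
  (forall D, exists i k, D = (i + d * k)%N /\ cost D = (i + 2 * k)%N) ->
  (forall n, uniq (sigma n)) ->
  (forall n, size (sigma n) = OP_dim 2 phi n) ->
  (forall n D e, ((D, e) \in sigma n) = (e < 2)%N && (cost D + e == n)%N) ->
  (forall n k, (k < size (sigma n))%N ->
    let: (D, e) := nth (0%N, 0%N) (sigma n) k in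
    Y n k.+1 = P2 phi p q (D + e) e) ->
  orthonormal_OP_basis I w Y.
Proof.
move=> sphi lphi lp lq cm cl ca su ss ms YE.
pose u e D : {poly R} := (Num.sqrt 2)^-1 *: (if e == 0%N then p D else q D).
have s2 : (Num.sqrt 2)^-1 != 0 :> R by rewrite invr_eq0 gt_eqF // sqrtr_gt0.
apply: (@graded_basis_OP R 2 d r phi I w _ mI momw _ sphi lphi cost cm cl ca u
  _ _ _ sigma su ss ms) => //.
- by right.
- by move=> e D _; rewrite /u size_scale //; case: ifP => _; rewrite ?hp.1 ?hq.1.
- move=> e D _ i; rewrite /u coefZ mulf_eq0 negb_or => /andP[_].
  by case: ifP => _; [exact: lp|exact: lq].
- move=> e D D' e2; rewrite /u -scalerAl -!scalerAr !scalerA.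
  rewrite -invfM -expr2 sqr_sqrtr // divff ?pnatr_eq0 // scale1r.
  case: e e2 => [|[|//]] _ /=; first by rewrite mul1r; exact: orthonormal_polysE.
  by rewrite expr1 -weighted_int_mul; exact: orthonormal_polysE.
- move=> n k kn; have := YE n k kn; have := mem_nth (0%N, 0%N) kn.
  case: (nth _ _ _) => D [|[|e]]; rewrite ms //= => _ ->; rewrite /P2 /ymonom /u /=.
    by rewrite addn0 expr0 mul1r.
  by rewrite addn1 expr1.
Qed.

End TwoSheets.
End CurveBases.

(** * Numbering of the bases for cubics and quartics *)

(** Each factor [phi] trades degree 3 in [x] for degree 2 on the curve, so the
    cheapest product of degree [D] has as many factors [phi] as fit. *)
Definition cubic_cost (D : nat) : nat := (2 * (D %/ 3) + D %% 3)%N.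

Definition cubic_table (n : nat) : seq (nat * nat) :=
  match n with
  | 0 => [:: (0, 0)]
  | 1 => [:: (1, 0); (0, 1)]
  | _ => let N := n./2 in
         if odd n then [:: (3 * N - 1, 1); (3 * N + 1, 0); (3 * N, 1)]
         else [:: (3 * N - 1, 0); (3 * N - 2, 1); (3 * N, 0)]
  end%N.

(** Again as many factors [phi] as fit. This is not monotone: degree [4 * k + 3]
    costs [2 * k + 3], more than the [2 * k + 2] of degree [4 * k + 4]. It is
    monotone on even and on odd degrees, which is why the quartic needs
    symmetry. *)
Definition quartic_cost (D : nat) : nat := (2 * (D %/ 4) + D %% 4)%N.

Definition quartic_table (n : nat) : seq (nat * nat) :=
  match n with
  | 0 => [:: (0, 0)]
  | 1 => [:: (1, 0); (0, 1)]
  | 2 => [:: (2, 0); (1, 1); (4, 0)]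
  | _ => let N := n.-1./2 in
         if odd n then [:: (4 * N - 1, 0); (4 * N - 2, 1); (4 * N + 1, 0); (4 * N, 1)]
         else [:: (4 * N - 1, 1); (4 * N + 2, 0); (4 * N + 1, 1); (4 * N + 4, 0)]
  end%N.

Lemma mem_cubic_table n D e :
  ((D, e) \in cubic_table n) = (e < 2)%N && (cubic_cost D + e == n)%N.
Proof.
rewrite /cubic_table /cubic_cost.
case: n => [|[|n]]; last case: ifP => on;
  rewrite !inE !xpair_eqE; apply/idP/idP => H; lia.
Qed.

Lemma mem_quartic_table n D e :
  ((D, e) \in quartic_table n) = (e < 2)%N && (quartic_cost D + e == n)%N.
Proof.
rewrite /quartic_table /quartic_cost.
case: n => [|[|[|n]]]; last case: ifP => on;
  rewrite !inE !xpair_eqE; apply/idP/idP => H; lia.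
Qed.

Lemma uniq_cubic_table n : uniq (cubic_table n).
Proof.
by rewrite /cubic_table; case: n => [|[|n]] //; case: ifP => _;
  rewrite /= !inE !xpair_eqE; lia.
Qed.

Lemma uniq_quartic_table n : uniq (quartic_table n).
Proof.
by rewrite /quartic_table; case: n => [|[|[|n]]] //; case: ifP => _;
  rewrite /= !inE !xpair_eqE; lia.
Qed.

Theorem proposition4p1 (R : realType) (I : set R) (w : R -> R)
    (phi : {poly R}) (p : nat -> {poly R})
    (hw : weight_on I w) (hp : orthonormal_polys I w p) :
  (* (1) *)
  (size phi = 2%N ->
   forall Y : nat -> nat -> curve_ring 1 phi,
   (forall n, Y n 1%N = P1 phi p n) ->
   orthonormal_OP_basis I w Y)
  /\
  (* (2) *)
  (size phi = 3%N ->
   forall Y : nat -> nat -> curve_ring 1 phi,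
   Y 0%N 1%N = P1 phi p 0 ->
   (forall n, (1 <= n)%N ->
      Y n 1%N = P1 phi p (2 * n - 1) /\ Y n 2%N = P1 phi p (2 * n)) ->
   orthonormal_OP_basis I w Y)
  /\
  (* (3), (4), (5): m = 2 *)
  ((forall x, I x -> 0 < phi.[x]) ->
   forall q : nat -> {poly R},
   orthonormal_polys I (fun x => phi.[x] * w x) q ->
   [/\ (* (3) *)
       size phi = 2%N \/ size phi = 3%N ->
       forall Y : nat -> nat -> curve_ring 2 phi,
       Y 0%N 1%N = P2 phi p q 0 0 ->
       (forall n, (1 <= n)%N ->
          Y n 1%N = P2 phi p q n 0 /\ Y n 2%N = P2 phi p q n 1) ->
       orthonormal_OP_basis I w Y,
       (* (4) *)
       size phi = 4%N ->
       forall Y : nat -> nat -> curve_ring 2 phi,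
       Y 0%N 1%N = P2 phi p q 0 0 ->
       Y 1%N 1%N = P2 phi p q 1 0 ->
       Y 1%N 2%N = P2 phi p q 1 1 ->
       (forall n, (1 <= n)%N ->
          [/\ Y (2 * n)%N 1%N = P2 phi p q (3 * n - 1) 0,
              Y (2 * n)%N 2%N = P2 phi p q (3 * n - 1) 1
            & Y (2 * n)%N 3%N = P2 phi p q (3 * n) 0]) ->
       (forall n, (1 <= n)%N ->
          [/\ Y (2 * n + 1)%N 1%N = P2 phi p q (3 * n) 1,
              Y (2 * n + 1)%N 2%N = P2 phi p q (3 * n + 1) 0
            & Y (2 * n + 1)%N 3%N = P2 phi p q (3 * n + 1) 1]) ->
       orthonormal_OP_basis I w Y
     & (* (5) *)
       forall a : R, 0 < a -> I = [set` `]- a, a[] ->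
       size phi = 5%N ->
       (forall x, phi.[- x] = phi.[x]) ->
       (forall x, I x -> w (- x) = w x) ->
       (forall n x, (p n).[- x] = (-1) ^+ n * (p n).[x]) /\
       forall Y : nat -> nat -> curve_ring 2 phi,
       Y 0%N 1%N = P2 phi p q 0 0 ->
       Y 1%N 1%N = P2 phi p q 1 0 ->
       Y 1%N 2%N = P2 phi p q 1 1 ->
       Y 2%N 1%N = P2 phi p q 2 0 ->
       Y 2%N 2%N = P2 phi p q 2 1 ->
       Y 2%N 3%N = P2 phi p q 4 0 ->
       (forall n, (1 <= n)%N ->
          [/\ Y (2 * n + 1)%N 1%N = P2 phi p q (4 * n - 1) 0,
              Y (2 * n + 1)%N 2%N = P2 phi p q (4 * n - 1) 1,
              Y (2 * n + 1)%N 3%N = P2 phi p q (4 * n + 1) 0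
            & Y (2 * n + 1)%N 4%N = P2 phi p q (4 * n + 1) 1]) ->
       (forall n, (1 <= n)%N ->
          [/\ Y (2 * n + 2)%N 1%N = P2 phi p q (4 * n) 1,
              Y (2 * n + 2)%N 2%N = P2 phi p q (4 * n + 2) 0,
              Y (2 * n + 2)%N 3%N = P2 phi p q (4 * n + 2) 1
            & Y (2 * n + 2)%N 4%N = P2 phi p q (4 * n + 4) 0]) ->
       orthonormal_OP_basis I w Y]).
Proof.
have mI : measurable I by apply: measurable_admissible; exact: weight_interval hw.
have momw : finite_moments I w := weight_moments hw.
split; [|split].
- move=> sphi Y YE.
  apply: (@graded_basis_OP1 R I w phi p mI momw hp 1 id (fun n => [:: (n, 0%N)])
    Y sphi) => //.
  + by move=> i k; rewrite mul1n.
  + by move=> D; exists D, 0%N; rewrite !addn0.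
  + by move=> n; rewrite /OP_dim sphi /=; lia.
  + by move=> n D e; rewrite inE xpair_eqE; apply/idP/idP; lia.
  + by move=> n [|//] _; rewrite YE.
- move=> sphi Y Y0 YE.
  apply: (@graded_basis_OP1 R I w phi p mI momw hp 2 uphalf (fun n =>
    if n is 0%N then [:: (0, 0)] else [:: (2 * n - 1, 0); (2 * n, 0)])%N
    Y sphi) => //.
  + by move=> k l; lia.
  + by move=> i k; lia.
  + by move=> D; exists (D %% 2)%N, (D %/ 2)%N; lia.
  + by case=> [|n] //=; rewrite !inE xpair_eqE; lia.
  + by case=> [|n]; rewrite /OP_dim sphi /=; lia.
  + by case=> [|n] D e; rewrite !inE !xpair_eqE; apply/idP/idP; lia.
  + case=> [|n] k; first by case: k => [|[]].
    have [//|Y1 Y2] := YE n.+1.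
    by case: k => [|[|[]]].
move=> phi_gt0 q hq; split.
- move=> sphi Y Y0 YE.
  have [d [sd d12]] : exists d, size phi = d.+1 /\ (d = 1 \/ d = 2)%N.
    by case: sphi => sphi; [exists 1%N|exists 2%N]; split => //; [left|right].
  apply: (@graded_basis_OP2 R I w phi p mI momw hp q phi_gt0 hq d 1 id (fun n =>
    if n is 0%N then [:: (0, 0)] else [:: (n, 0); (n - 1, 1)])%N Y sd (lacunary1 0 phi)
    (fun n => lacunary1 n (p n)) (fun n => lacunary1 n (q n))) => //.
  + by move=> i k /=; case: d12 => ->; lia.
  + by move=> D; exists D, 0%N; rewrite !muln0 !addn0.
  + by case=> [|n] //=; rewrite !inE xpair_eqE; lia.
  + by case=> [|n]; rewrite /OP_dim sd /=; lia.
  + by case=> [|n] D e; rewrite !inE !xpair_eqE; apply/idP/idP; lia.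
  + case=> [|n] k; first by case: k => [|[]].
    have [//|Y1 Y2] := YE n.+1.
    case: k => [|[|k]] kn; last (by discriminate kn);
      [rewrite Y1|rewrite Y2]; congr P2; lia.
- move=> sphi Y Y01 Y11 Y12 Yeven Yodd.
  apply: (@graded_basis_OP2 R I w phi p mI momw hp q phi_gt0 hq 3 1 cubic_cost
    cubic_table Y sphi (lacunary1 0 phi)
    (fun n => lacunary1 n (p n)) (fun n => lacunary1 n (q n))) => //.
  + by move=> k l kl _; rewrite /cubic_cost; lia.
  + by move=> i k; rewrite /cubic_cost; lia.
  + by move=> D; exists (D %% 3)%N, (D %/ 3)%N; rewrite /cubic_cost; lia.
  + exact: uniq_cubic_table.
  + by rewrite /cubic_table /OP_dim sphi; case=> [|[|n]] //; case: ifP => _ /=; lia.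
  + exact: mem_cubic_table.
  + case=> [|[|n]] k.
    - by case: k => [|k] kn; [exact: Y01|discriminate kn].
    - by case: k => [|[|k]] kn; [exact: Y11|exact: Y12|discriminate kn].
    rewrite /cubic_table; case: ifP => on.
      have : n.+2 = (2 * (n.+2)./2 + 1)%N by lia.
      move: (n.+2)./2 => N nN; have [|Y1 Y2 Y3] := Yodd N; first by lia.
      rewrite nN; case: k => [|[|[|k]]] kn; last (by discriminate kn);
        [rewrite Y1|rewrite Y2|rewrite Y3]; congr P2; lia.
    have : n.+2 = (2 * (n.+2)./2)%N by lia.
    move: (n.+2)./2 => N nN; have [|Y1 Y2 Y3] := Yeven N; first by lia.
    rewrite nN; case: k => [|[|[|k]]] kn; last (by discriminate kn);
      [rewrite Y1|rewrite Y2|rewrite Y3]; congr P2; lia.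
- move=> a a0 Ia sphi ephi ew; subst I.
  have mw := weight_measurable hw.
  have parp := orthonormal_polys_parity _ _ _ _ mw momw ew hp.
  split=> [n x|].
    have := congr1 (fun f : {poly R} => f.[x]) (parp n).
    by rewrite horner_comp hornerN hornerX hornerZ.
  have parq : forall n, q n \Po - 'X = (-1) ^+ n *: q n.
    apply: (orthonormal_polys_parity _ _ _ _ _ _ _ hq).
    - apply: measurable_funM => //.
      by apply: continuous_measurable_fun; exact: continuous_horner.
    - exact: finite_moments_mul.
    - by move=> x Ix; rewrite ephi ew.
  move=> Y Y01 Y11 Y12 Y21 Y22 Y23 Yodd Yeven.
  apply: (@graded_basis_OP2 R _ w phi p mI momw hp q phi_gt0 hq 4 2 quartic_cost
    quartic_table Y sphi) => //.
  + exact: even_lacunary.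
  + by move=> n; exact: lacunary_comp_polyNX.
  + by move=> n; exact: lacunary_comp_polyNX.
  + by move=> k l kl; rewrite /quartic_cost; lia.
  + by move=> i k; rewrite /quartic_cost; lia.
  + by move=> D; exists (D %% 4)%N, (D %/ 4)%N; rewrite /quartic_cost; lia.
  + exact: uniq_quartic_table.
  + by rewrite /quartic_table /OP_dim sphi; case=> [|[|[|n]]] //; case: ifP => _ /=; lia.
  + exact: mem_quartic_table.
  + case=> [|[|[|n]]] k.
    - by case: k => [|k] kn; [exact: Y01|discriminate kn].
    - by case: k => [|[|k]] kn; [exact: Y11|exact: Y12|discriminate kn].
    - by case: k => [|[|[|k]]] kn;
        [exact: Y21|exact: Y22|exact: Y23|discriminate kn].
    rewrite /quartic_table; case: ifP => on.
      have : n.+3 = (2 * (n.+3.-1)./2 + 1)%N by lia.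
      move: (n.+3.-1)./2 => N nN; have [|Y1 Y2 Y3 Y4] := Yodd N; first by lia.
      rewrite nN; case: k => [|[|[|[|k]]]] kn; last (by discriminate kn);
        [rewrite Y1|rewrite Y2|rewrite Y3|rewrite Y4]; congr P2; lia.
    have : n.+3 = (2 * (n.+3.-1)./2 + 2)%N by lia.
    move: (n.+3.-1)./2 => N nN; have [|Y1 Y2 Y3 Y4] := Yeven N; first by lia.
    rewrite nN; case: k => [|[|[|[|k]]]] kn; last (by discriminate kn);
      [rewrite Y1|rewrite Y2|rewrite Y3|rewrite Y4]; congr P2; lia.
Qed.
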